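(* Suppose that for each $k\in\{1,\ldots,s\}$ there exist two finite sequences $(\eta_1,\ldots,\eta_P)\in\{1,\ldots,m\}^P$ and $(\omega_1,\ldots,\omega_Q)\in\{1,\ldots,m\}^Q$ (depending on $k$) such that $$T_{\eta_1\ldots\eta_P}(a_k)\in\bigcup_{i=1}^s(a_i,b_i)\quad\text{and}\quad T_{\omega_1\ldots\omega_Q}(b_k)\in\bigcup_{i=1}^s(a_i,b_i).$$ Then $\widetilde U$ is a subshift of finite type.
   Context: Let $f_j(x)=r_jx+d_j$, $1\le j\le m$, with $0<r_j<1$ and $d_j\in\mathbb{R}$, be an iterated function system on $\mathbb{R}$, and let $K$ be its attractor, i.e. the unique non-empty compact set with $K=\bigcup_{j=1}^m f_j(K)$. Assume $K=[a,b]$ is a (nondegenerate) interval. The projection map is $\pi:\{1,\ldots,m\}^{\mathbb{N}}\to K$, $\pi((i_n)_{n=1}^\infty)=\lim_{n\to\infty}f_{i_1}\circ\cdots\circ f_{i_n}(0)$; a coding of $x\in K$ is a sequence $(i_n)$ with $\pi((i_n))=x$. The univoque set $U$ is the set of $x\in K$ having exactly one coding, and $\widetilde U=\pi^{-1}(U)$. Put $T_j=f_j^{-1}$ and $T_{i_1\ldots i_n}=T_{i_n}\circ\cdots\circ T_{i_1}$ (maps on $\mathbb{R}$), and $I_j=f_j(K)$. Let $H_1,\ldots,H_s$ be the non-empty intersections $I_i\cap I_j$ with $i\ne j$ (the switch regions). It is assumed that each $H_k=[a_k,b_k]$ is a nontrivial interval contained in the interior of $K$, and that the $H_k$ are pairwise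 disjoint and listed from left to right. A subset of $\{1,\ldots,m\}^{\mathbb{N}}$ is a subshift of finite type if it is the set of all sequences in which no word from some finite set of forbidden finite words occurs as a block of consecutive digits. *)

(* Defs.v *)
From HB Require Import structures.
From mathcomp Require Import all_boot all_order all_algebra.
From mathcomp Require Import all_classical all_reals all_analysis.
Import Order.TTheory GRing.Theory Num.Theory.
Import numFieldNormedType.Exports.

Set Implicit Arguments.
Unset Strict Implicit.
Unset Printing Implicit Defensive.

Local Open Scope classical_set_scope.
Local Open Scope ring_scope.

Section IFS.
Context {R : realType} {m : nat}.
Implicit Types (r d : 'I_m -> R) (K : set R) (x : R).

Definition ifs r d (j : 'I_m) x : R := r j * x + d j.

(* The inverse of [ifs r d j] on the whole line; see [ifsK] and [ifs_invK]. *)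
Definition ifs_inv r d (j : 'I_m) x : R := (x - d j) / r j.

Lemma ifsK r d j : 0 < r j -> cancel (ifs r d j) (ifs_inv r d j).
Proof. by move=> r0 x; rewrite /ifs_inv /ifs addrK mulrC mulKf ?gt_eqF. Qed.

Lemma ifs_invK r d j : 0 < r j -> cancel (ifs_inv r d j) (ifs r d j).
Proof. by move=> r0 x; rewrite /ifs /ifs_inv mulrC divfK ?subrK ?gt_eqF. Qed.

(* f_{i_1} o ... o f_{i_n}: the last letter of the word is applied first. *)
Definition ifs_word r d (w : seq 'I_m) x : R := foldr (ifs r d) x w.

(* T_{i_1 ... i_n} = T_{i_n} o ... o T_{i_1}: the first letter is applied
   first. *)
Definition ifs_inv_word r d (w : seq 'I_m) x : R :=
  foldl (fun y j => ifs_inv r d j y) x w.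

Definition is_attractor r d K : Prop :=
  [/\ K !=set0, compact K & K = \bigcup_j (ifs r d j @` K)].

(* Digit sequences are indexed from 0, so [mkseq u n] is the word formed by
   the first n digits. *)
Definition ifs_proj r d (u : nat -> 'I_m) : R :=
  limn (fun n => ifs_word r d (mkseq u n) 0).

Definition is_coding r d x (u : nat -> 'I_m) : Prop := ifs_proj r d u = x.

Definition univoque_set r d K : set R :=
  [set x | K x /\ exists! u, is_coding r d x u].

Definition univoque_codings r d K : set (nat -> 'I_m) :=
  ifs_proj r d @^-1` univoque_set r d K.

(* A set of sets: an intersection arising from several pairs (i, j), for
   instance from (i, j) and (j, i), is a single switch region. *)
Definition switch_regions r d K : set (set R) :=
  [set H | H !=set0 /\ exists i j : 'I_m,
    i != j /\ H = (ifs r d i @` K) `&` (ifs r d j @` K)].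

End IFS.

Definition occurs_in {A : eqType} (w : seq A) (u : nat -> A) : Prop :=
  exists n, [seq u i | i <- iota n (size w)] = w.

Definition is_subshift_of_finite_type {A : eqType} (X : set (nat -> A)) : Prop :=
  exists F : seq (seq A),
    X = [set u | forall w, w \in F -> ~ occurs_in w u].

(* Main.v *)
Require Import Defs.
From HB Require Import structures.
From mathcomp Require Import all_boot all_order all_algebra.
From mathcomp Require Import all_classical all_reals all_analysis.
From mathcomp Require Import lra.
Import Order.TTheory GRing.Theory Num.Theory.
Import numFieldNormedType.Exports.

Set Implicit Arguments.
Unset Strict Implicit.
Unset Printing Implicit Defensive.

Local Open Scope classical_set_scope.
Local Open Scope ring_scope.

(** A sequence [u] fails to be univoque exactly when the orbit of its point
    under the shift meets a switch region: two distinct codings of a point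
    first disagree at some position [n], and there
    [ifs_proj (sdrop n u)] lies in two different cylinders of level one.

    What turns this into a condition on finitely many words is that a whole
    neighbourhood of the switch regions contains no univoque point
    ([near_switch_region_not_univoque]).  Points of a switch region have two
    codings.  A point [y] close to an endpoint [x] of a switch region is sent
    by [T_eta] into the interior of a switch region, because [T_eta] is
    continuous and sends [x] there; so [T_eta y] has two codings, and
    prefixing both with [eta] gives two codings of [y].  It does not matter
    whether the coding of [y] under consideration begins with [eta].

    Let the neighbourhood have radius [delta], and take [N] so large that
    every cylinder of level [N] has diameter less than [delta].  The forbidden
    words are the words of length [N] whose cylinder contains no univoque
    point.  A univoque sequence avoids them because shifts of univoque
    sequences are univoque; a non-univoque one contains the word read from the
    position where its orbit hits a switch region
    ([univoque_codings_sft]). *)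

(** * Shifting and prefixing sequences *)

Section Sequences.
Context {A : eqType}.
Implicit Types (u v : nat -> A) (w : seq A).

Definition sdrop n u : nat -> A := fun k => u (n + k)%N.

(** The default value of [nth] supplies the digits beyond [w]. *)
Definition scat w u : nat -> A := fun n => nth (u (n - size w)%N) w n.

Lemma scat0 u : scat [::] u = u.
Proof. by apply/funext => n; rewrite /scat /= nth_nil subn0. Qed.

Lemma scat_cons (i : A) w u : sdrop 1 (scat (i :: w) u) = scat w u.
Proof. by []. Qed.

Lemma scat_inj w : injective (scat w).
Proof.
move=> u v uv; apply/funext => n; have := congr1 (fun f => f (size w + n)%N) uv.
by rewrite /scat !nth_default ?leq_addr// addKn.
Qed.

Lemma mkseq_sdrop1 u n : mkseq u n.+1 = u 0%N :: mkseq (sdrop 1 u) n.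
Proof. by rewrite /mkseq /= (iotaDl 1 0) -map_comp. Qed.

Lemma map_iota_sdrop u n k : [seq u i | i <- iota n k] = mkseq (sdrop n u) k.
Proof. by rewrite -(addn0 n) iotaDl -map_comp addn0. Qed.

Lemma first_difference u v : u <> v ->
  exists n, u n != v n /\ forall k, (k < n)%N -> u k = v k.
Proof.
move=> uv; have ex : exists n, u n != v n.
  apply: contrapT => nex; apply: uv; apply/funext => n.
  by apply: contrapT => /eqP unv; apply: nex; exists n.
have [n unv nmin] := ex_minnP ex; exists n; split => // k kn.
by apply/eqP; apply: contraTT kn => /nmin; rewrite -leqNgt.
Qed.

End Sequences.

(** * The projection of a contracting system *)

Section Projection.
Context {R : realType} {m : nat} (r d : 'I_m -> R).
Context (hr : forall j, 0 < r j < 1).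
Implicit Types (u : nat -> 'I_m) (w : seq 'I_m).

Lemma contraction_ratio :
  exists2 rho : R, 0 <= rho < 1 & forall j, r j <= rho.
Proof.
exists (\big[Order.max/0]_j r j); last by move=> j; exact: le_bigmax.
by rewrite bigmax_ge_id bigmax_lt// => j _; case/andP: (hr j).
Qed.

Lemma ifs_word_contraction (rho : R) w x y : (forall j, r j <= rho) ->
  `|ifs_word r d w x - ifs_word r d w y| <= rho ^+ size w * `|x - y|.
Proof.
move=> hrho; elim: w => [|j w IH] /=; first by rewrite expr0 mul1r.
have /andP[rj0 _] := hr j.
rewrite /ifs opprD addrACA subrr addr0 -mulrBr normrM exprS -mulrA.
by rewrite ger0_norm ?(ltW rj0)// ler_pM// ltW.
Qed.

Lemma ifs_wordK w : cancel (ifs_inv_word r d w) (ifs_word r d w).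
Proof.
move=> x; elim: w x => [//|j w IH] x /=; rewrite IH ifs_invK//.
by case/andP: (hr j).
Qed.

Lemma continuous_ifs j : continuous (ifs r d j).
Proof.
move=> x; apply: cvgD; last exact: cvg_cst.
by apply: cvgM; [exact: cvg_cst | exact: cvg_id].
Qed.

Lemma continuous_ifs_inv_word w : continuous (ifs_inv_word r d w).
Proof.
elim: w => [|j w IH] x; first exact: cvg_id.
have cj : {for x, continuous (ifs_inv r d j)}.
  apply: cvgM; last exact: cvg_cst.
  by apply: cvgB; [exact: cvg_id | exact: cvg_cst].
exact: (continuous_comp cj (IH _)).
Qed.

Lemma is_cvg_ifs_word u : cvgn (fun n => ifs_word r d (mkseq u n) 0).
Proof.
have [rho /andP[rho0 rho1] hrho] := contraction_ratio.
pose p n := ifs_word r d (mkseq u n) 0.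
have M0 : 0 <= \sum_j `|d j| by apply: sumr_ge0.
(* Consecutive terms differ by the image of d_{u n} - 0 under n contractions,
   so the series of differences is dominated by a geometric one. *)
have dom n : `|telescope p n| <= geometric (\sum_j `|d j|) rho n.
  rewrite -[telescope p n]/(p n.+1 - p n) /p mkseqS /ifs_word foldr_rcons.
  apply: le_trans (ifs_word_contraction _ _ _ hrho) _.
  rewrite size_mkseq mulrC ler_wpM2r ?exprn_ge0//.
  rewrite subr0 /ifs mulr0 add0r (bigD1 (u n))//= lerDl.
  exact: sumr_ge0.
have ctel : cvgn (series (telescope p)).
  apply: normed_cvg; apply: series_le_cvg dom _ => //.
    by move=> n; rewrite /geometric /= mulr_ge0// exprn_ge0.
  by apply: is_cvg_geometric_series; rewrite ger0_norm.
rewrite -[X in cvg (X @ _)]/p (funext (eq_sum_telescope p)).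
by apply: is_cvgD => //; exact: is_cvg_cst.
Qed.

(** The base point of the projection may move with [n] as long as it stays
    bounded. *)
Lemma cvg_ifs_word u (x : nat -> R) (M : R) : (forall n, `|x n| <= M) ->
  ifs_word r d (mkseq u n) (x n) @[n --> \oo] --> ifs_proj r d u.
Proof.
move=> xM; have [rho /andP[rho0 rho1] hrho] := contraction_ratio.
pose p n := ifs_word r d (mkseq u n) 0.
have gap : (ifs_word r d (mkseq u n) (x n) - p n) @[n --> \oo] --> 0.
  apply/norm_cvg0P; apply: (@squeeze_cvgr _ _ _ _ (cst 0) (geometric M rho)).
  - near=> n; rewrite normr_ge0 /=.
    apply: le_trans (ifs_word_contraction _ _ _ hrho) _.
    by rewrite size_mkseq subr0 mulrC ler_wpM2r ?exprn_ge0.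
  - exact: cvg_cst.
  - by apply: cvg_geometric; rewrite ger0_norm.
have -> : (fun n => ifs_word r d (mkseq u n) (x n)) =
    (fun n => ifs_word r d (mkseq u n) (x n) - p n + p n).
  by apply/funext => n; rewrite subrK.
rewrite -[X in _ --> X]add0r.
by apply: cvgD gap _; exact: is_cvg_ifs_word.
Unshelve. all: by end_near. Qed.

Lemma ifs_proj_sdrop1 u :
  ifs_proj r d u = ifs r d (u 0%N) (ifs_proj r d (sdrop 1 u)).
Proof.
apply: cvg_lim => //; rewrite -cvg_shiftS.
under eq_fun do rewrite mkseq_sdrop1 /=.
apply: continuous_cvg; first exact: continuous_ifs.
exact: is_cvg_ifs_word.
Qed.

Lemma ifs_proj_scat w u :
  ifs_proj r d (scat w u) = ifs_word r d w (ifs_proj r d u).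
Proof.
by elim: w => [|i w IH]; rewrite ?scat0// ifs_proj_sdrop1 scat_cons IH.
Qed.

Lemma ifs_proj_mkseq u n :
  ifs_proj r d u = ifs_word r d (mkseq u n) (ifs_proj r d (sdrop n u)).
Proof.
rewrite -ifs_proj_scat; congr ifs_proj; apply/funext => k.
rewrite /scat size_mkseq; have [kn|nk] := ltnP k n; first by rewrite nth_mkseq.
by rewrite nth_default ?size_mkseq// /sdrop subnKC.
Qed.

End Projection.

(** * Codings of points of the attractor *)

Section Attractor.
Context {R : realType} {m : nat} (r d : 'I_m -> R) (K : set R).
Context (hr : forall j, 0 < r j < 1).
Context (hK : is_attractor r d K).
Implicit Types (u v : nat -> 'I_m) (w : seq 'I_m) (x y : R).

Local Notation U := (univoque_set r d K).

Lemma attractor_ifs j x : K x -> K (ifs r d j x).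
Proof. by case: hK => _ _ KE Kx; rewrite KE; exists j => //; exists x. Qed.

Lemma attractor_ifs_word w x : K x -> K (ifs_word r d w x).
Proof. by move=> Kx; elim: w => [//|j w IH] /=; exact: attractor_ifs. Qed.

Lemma attractor_bounded : exists M : R, forall x, K x -> `|x| <= M.
Proof.
have [_ /compact_bounded [M [_ hM]] _] := hK.
by exists (M + 1) => x Kx; apply: hM Kx; rewrite ltrDl.
Qed.

Lemma ifs_proj_attractor u : K (ifs_proj r d u).
Proof.
have [[x Kx] cK _] := hK; have [M hM] := attractor_bounded.
have closedK : closed K by apply: compact_closed cK; exact: Rhausdorff.
have cvg_u := @cvg_ifs_word _ _ r d hr u _ _ (fun=> hM _ Kx).
apply: (closed_cvg K closedK) cvg_u.
by apply: nearW => n; exact: attractor_ifs_word.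
Qed.

(** Following preimages inside [K] produces a coding: the orbit stays bounded,
    so the words read along it converge to the starting point. *)
Lemma attractor_coding x : K x -> exists u, ifs_proj r d u = x.
Proof.
move=> Kx; have [_ _ KE] := hK; have [M hM] := attractor_bounded.
have pre (y : {y | K y}) :
    exists p : 'I_m * {z | K z}, ifs r d p.1 (sval p.2) = sval y.
  case: y => y Ky /=; move: (Ky); rewrite {1}KE => -[j _ [z Kz <-]].
  by exists (j, exist _ z Kz).
have [step stepE] := choice pre.
pose orb n : {y | K y} := iter n (fun z => (step z).2) (exist _ x Kx).
pose u n := (step (orb n)).1.
have wordE n : ifs_word r d (mkseq u n) (sval (orb n)) = x.
  elim: n => [//|n IH]; rewrite mkseqS /ifs_word foldr_rcons -[RHS]IH.
  have orbS : orb n.+1 = (step (orb n)).2 by [].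
  by rewrite orbS stepE.
have cvg_u : cst x @ \oo --> ifs_proj r d u.
  rewrite -(funext wordE : _ = cst x).
  apply: (@cvg_ifs_word _ _ r d hr u _ M) => n.
  exact: hM (svalP (orb n)).
exists u; rewrite -(cvg_lim (@Rhausdorff R) cvg_u).
exact: lim_cst.
Qed.

Lemma univoque_coding_inj x u v :
  U x -> ifs_proj r d u = x -> ifs_proj r d v = x -> u = v.
Proof. by move=> [_ [c [_ cuniq]]] /cuniq <- /cuniq <-. Qed.

(** Prefixing [w] to two codings of [x] gives two codings of
    [ifs_word r d w x]. *)
Lemma univoque_ifs_word w x : K x -> U (ifs_word r d w x) -> U x.
Proof.
move=> Kx Uwx; split => //.
have [u ux] := attractor_coding Kx; exists u; split => // v vx.
apply: (@scat_inj _ w).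
by apply: (univoque_coding_inj Uwx); rewrite ifs_proj_scat// ?ux ?vx.
Qed.

Lemma univoque_codings_sdrop u n :
  univoque_codings r d K u -> univoque_codings r d K (sdrop n u).
Proof.
rewrite /univoque_codings /= (ifs_proj_mkseq d hr u n).
by apply: univoque_ifs_word; exact: ifs_proj_attractor.
Qed.

(** A common point of the images of [K] under two maps of the system has one
    coding beginning with the index of each map. *)
Lemma switch_region_not_univoque H x : switch_regions r d K H -> H x -> ~ U x.
Proof.
move=> [_ [i [j [/eqP ij ->]]]] [[p Kp px] [q Kq qx]] Ux.
have [u up] := attractor_coding Kp; have [v vq] := attractor_coding Kq.
apply: ij; have /(congr1 (fun f => f 0%N)) : scat [:: i] u = scat [:: j] v.
  by apply: (univoque_coding_inj Ux); rewrite ifs_proj_scat// ?up ?vq.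
by [].
Qed.

(** The point [ifs_inv_word r d w x] has two codings, and [w] followed by
    either of them is a coding of [x].  This applies to an
    arbitrary word [w], whatever the codings of [x] look like. *)
Lemma inv_word_switch_region_not_univoque H w x :
  switch_regions r d K H -> H (ifs_inv_word r d w x) -> ~ U x.
Proof.
move=> HH Hx Ux; apply: (switch_region_not_univoque HH Hx).
apply: (@univoque_ifs_word w); last by rewrite ifs_wordK.
have [_ [i [j [_ HE]]]] := HH.
by move: Hx; rewrite HE => -[[z Kz <-] _]; exact: attractor_ifs.
Qed.

(** Two codings of one point first disagree where its orbit is in a switch
    region. *)
Lemma nonunivoque_hits_switch u : ~ univoque_codings r d K u ->
  exists n H, switch_regions r d K H /\ H (ifs_proj r d (sdrop n u)).
Proof.
move=> nU.
have [v [vu uv]] : exists v, ifs_proj r d v = ifs_proj r d u /\ u <> v.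
  apply: contrapT => nex; apply: nU; split; first exact: ifs_proj_attractor.
  exists u; split => // v vu; apply: contrapT => uv; apply: nex.
  by exists v.
have [n [unv before]] := first_difference uv.
have same : ifs_proj r d (sdrop n v) = ifs_proj r d (sdrop n u).
  have mkE : mkseq v n = mkseq u n.
    apply: (@eq_from_nth _ (u 0%N)); rewrite !size_mkseq// => k kn.
    by rewrite !nth_mkseq// before.
  move: vu; rewrite (ifs_proj_mkseq d hr u n) (ifs_proj_mkseq d hr v n) mkE.
  elim: (mkseq u n) => [//|j w IH] /=.
  move=> /(can_inj (ifsK d (proj1 (andP (hr j))))); exact: IH.
(* The common point of the two shifted sequences lies in the two cylinders of
   level one given by the digits at position n. *)
have hit : ((ifs r d (u n) @` K) `&` (ifs r d (v n) @` K))
             (ifs_proj r d (sdrop n u)).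
  split; [|rewrite -same]; rewrite ifs_proj_sdrop1// /sdrop addn0;
    apply: imageP; exact: ifs_proj_attractor.
exists n, ((ifs r d (u n) @` K) `&` (ifs r d (v n) @` K)); split => //.
by split; [exists (ifs_proj r d (sdrop n u)) | exists (u n), (v n)].
Qed.

(** * Forbidden words *)

(** A gap [delta] between the switch regions and the univoque points makes the
    condition finite: a cylinder of diameter less than [delta] that meets a
    switch region contains no univoque point, so it can be forbidden by its
    word alone. *)
Lemma univoque_codings_sft (delta : R) : 0 < delta ->
  (forall H x y, switch_regions r d K H -> H x -> `|x - y| < delta -> ~ U y) ->
  is_subshift_of_finite_type (univoque_codings r d K).
Proof.
move=> delta0 hdelta.
have [rho /andP[rho0 rho1] hrho] := contraction_ratio hr.
have [M hM] := attractor_bounded.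
(* K has diameter at most M + M, a cylinder of level N at most
   rho ^+ N * (M + M). *)
have [N hN] : exists N, geometric (M + M) rho N < delta.
  have /cvgr0_norm_lt /(_ _ delta0) :
      geometric (M + M) rho n @[n --> \oo] --> 0.
    by apply: cvg_geometric; rewrite ger0_norm.
  by move=> /filter_ex [N /ltr_normlW ?]; exists N.
exists [seq w <- [seq val t | t <- enum {: N.-tuple 'I_m}] |
         `[< forall y, K y -> ~ U (ifs_word r d w y) >]].
have forbiddenE w :
    w \in [seq w <- [seq val t | t <- enum {: N.-tuple 'I_m}] |
         `[< forall y, K y -> ~ U (ifs_word r d w y) >]] <->
    size w = N /\ (forall y, K y -> ~ U (ifs_word r d w y)).
  rewrite mem_filter; split.
    move=> /andP[/asboolP nUw /mapP[t _ wt]]; split=> //.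
    by rewrite wt size_tuple.
  move=> [wN nUw]; apply/andP; split; first exact/asboolP.
  apply/mapP; exists (Tuple (introT eqP wN)) => //; exact: mem_enum.
apply/seteqP; split => u /=.
  move=> Uu w /forbiddenE[_ nUw] [n nw].
  have := univoque_codings_sdrop n Uu; rewrite /univoque_codings /=.
  rewrite (ifs_proj_mkseq d hr _ (size w)) -map_iota_sdrop nw.
  exact/nUw/ifs_proj_attractor.
move=> avoid; apply: contrapT => /nonunivoque_hits_switch[n [H [HH Hn]]].
apply: (avoid (mkseq (sdrop n u) N)); last first.
  by exists n; rewrite map_iota_sdrop size_mkseq.
apply/forbiddenE; rewrite size_mkseq; split => // y Ky.
apply: hdelta HH Hn _; apply: le_lt_trans hN.
rewrite (ifs_proj_mkseq d hr _ N) /geometric /= mulrC.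
apply: le_trans (ifs_word_contraction d hr _ _ _ hrho) _.
rewrite size_mkseq ler_wpM2l ?exprn_ge0//.
apply: le_trans (ler_normB _ _) _.
by rewrite lerD// hM//; exact: ifs_proj_attractor.
Qed.

End Attractor.

(** * A neighbourhood of the switch regions *)

(** A point at distance less than [e] from [[a, b]] either belongs to it, and
    then has two codings, or is at distance less than [e] from [a] or [b]; so
    only the two endpoints need a neighbourhood free of univoque points. *)
Lemma near_switch_region_not_univoque (R : realType) (m : nat) (r d : 'I_m -> R)
    (K : set R) (a b : R) :
  (forall j, 0 < r j < 1) -> is_attractor r d K ->
  switch_regions r d K `[a, b]%classic ->
  (\forall y \near a, ~ univoque_set r d K y) ->
  (\forall y \near b, ~ univoque_set r d K y) ->
  \forall e \near 0^'+, forall x y, `[a, b]%classic x -> `|x - y| < e ->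
    ~ univoque_set r d K y.
Proof.
move=> hr hK Hab /nbhs_ballP[ea /= ea0 nUa] /nbhs_ballP[eb /= eb0 nUb].
near=> e => x y; rewrite /= in_itv /= => /andP[ax xb].
have eea : e <= ea by near: e; exact: nbhs_right_le.
have eeb : e <= eb by near: e; exact: nbhs_right_le.
rewrite ltr_distlC => /andP[xye yxe].
have [ya|ay] := ltP y a.
  by apply: nUa; rewrite /ball /= ltr_distlC; apply/andP; split; lra.
have [yb|yb] := ltP b y.
  by apply: nUb; rewrite /ball /= ltr_distlC; apply/andP; split; lra.
by apply: switch_region_not_univoque Hab _; rewrite //= in_itv /= ay.
Unshelve. all: by end_near. Qed.

Theorem theorem2p4 (R : realType) (m : nat) (r d : 'I_m -> R)
  (hr : forall j, 0 < r j < 1)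
  (K : set R) (hK : is_attractor r d K)
  (a b : R) (hab : a < b) (hKab : K = `[a, b]%classic)
  (s : nat) (sa sb : 'I_s -> R)
  (hH : switch_regions r d K = range (fun k : 'I_s => `[sa k, sb k]%classic))
  (hlt : forall k, sa k < sb k)
  (hint : forall k, `[sa k, sb k]%classic `<=` interior K)
  (hdisj : trivIset [set: 'I_s] (fun k : 'I_s => `[sa k, sb k]%classic))
  (hleft : forall k l : 'I_s, (k < l)%N -> sa k < sa l)
  (hyp : forall k : 'I_s,
    (exists eta : seq 'I_m,
       (\bigcup_(i : 'I_s) `]sa i, sb i[%classic) (ifs_inv_word r d eta (sa k))) /\
    (exists omega : seq 'I_m,
       (\bigcup_(i : 'I_s) `]sa i, sb i[%classic) (ifs_inv_word r d omega (sb k)))) :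
  is_subshift_of_finite_type (univoque_codings r d K).
Proof.
have region k : switch_regions r d K `[sa k, sb k]%classic.
  by rewrite hH; exists k.
have near_endpoint x w :
    (\bigcup_(i : 'I_s) `]sa i, sb i[%classic) (ifs_inv_word r d w x) ->
    \forall y \near x, ~ univoque_set r d K y.
  move=> [i _ xi]; have ni : \forall y \near x,
      `]sa i, sb i[%classic (ifs_inv_word r d w y).
    apply: (@continuous_ifs_inv_word _ _ r d w x).
    exact: open_nbhs_nbhs (conj (@interval_open _ _ _ _ _) xi).
  near=> y; apply: (inv_word_switch_region_not_univoque hr hK (region i)).
  have yi : `]sa i, sb i[%classic (ifs_inv_word r d w y) by near: y.
  exact: subset_itv_oo_cc yi.
have [e [e0 he]] : exists e : R, 0 < e /\ forall k x y,
    `[sa k, sb k]%classic x -> `|x - y| < e -> ~ univoque_set r d K y.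
  apply: (@filter_ex _ (0 : R)^'+); apply: filterI; first exact: nbhs_right_gt.
  apply: (@filter_forall R _ _ (0 : R)^'+) => k.
  have [[eta ha] [omega hb]] := hyp k.
  exact: near_switch_region_not_univoque hr hK (region k)
    (near_endpoint _ _ ha) (near_endpoint _ _ hb).
apply: (univoque_codings_sft hr hK e0) => H x y.
by rewrite hH => -[k _ <-]; exact: he.
Unshelve. all: by end_near. Qed.
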